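(* Fix $k,l,m,n\in\mathbb{N}$ with $k\le m$, $l\le n$, and $k,l$ even. For every set $\Gamma$ of formulas of $\mathcal{L}_{\mathsf{MBCL}}$ and every formula $A$: if $\Gamma\vdash_{Ax_{\mathsf{MBCL}}^{k,l,m,n}}A$, then $\Gamma\vDash_{\mathbf{F}^{k,l,m,n}}A$.
   Context: $\mathcal{L}_{\mathsf{MBCL}}$ has variables $p_0,p_1,\dots$ (set $\mathrm{Var}$), unary $\neg,\Box,\Diamond$, binary $\wedge,\vee,\rightarrow$; $\mathrm{For}$ its formulas. $A\supset B:=\neg A\vee B$, $A\equiv B:=(\neg A\vee B)\wedge(\neg B\vee A)$; $\neg^jA$ is $A$ preceded by $j$ negations. A model is $\langle W,Q,\{R_w\}_{w\in W},v\rangle$ with $W\neq\emptyset$, $Q\subseteq W\times W$, $R_w\subseteq\mathrm{For}\times\mathrm{For}$ for each $w$, $v:W\times\mathrm{Var}\to\{0,1\}$; the triple $\langle W,Q,\{R_w\}\rangle$ is its frame. Truth at $w$: $p$ iff $v(w,p)=1$; $\neg,\wedge,\vee$ classical at $w$; $\Box B$ iff $B$ true at every $u$ with $Q(w,u)$; $\Diamond B$ iff $B$ true at some $u$ with $Q(w,u)$; $B\rightarrow C$ iff ($B$ false at $w$ or $C$ true at $w$) and $R_w(B,C)$. Conditions on a relation $R$ (for all $A,B$): (a1) not $R(A,\neg A)$; (a2) not $R(\neg A,A)$; (b0) $R(A,B)\Rightarrow$ not $R(A,\neg B)$; (b1) $R(A\rightarrow B,\neg(A\rightarrow\neg B))$;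 (b2) $R(A\rightarrow\neg B,\neg(A\rightarrow B))$; (cun) $R(A,B)\Rightarrow R(\neg A,\neg B)$; (cun$^{k,l,m,n}$) $R(\neg^kA,\neg^lB)\Rightarrow R(\neg^mA,\neg^nB)$. $\mathbf{F}^{k,l,m,n}$ is the class of frames in which every $R_w$ satisfies all these conditions. $\Gamma\vDash_{\mathbf{F}^{k,l,m,n}}A$: for every model on a frame in $\mathbf{F}^{k,l,m,n}$ and every world $w$, if all members of $\Gamma$ are true at $w$ then $A$ is true at $w$. $Ax_{\mathsf{MBCL}}^{k,l,m,n}$ has axiom schemata: (CPL) substitution instances of classical tautologies; $\neg(A\rightarrow\neg A)$; $\neg(\neg A\rightarrow A)$; $(A\rightarrow B)\rightarrow\neg(A\rightarrow\neg B)$; $(A\rightarrow\neg B)\rightarrow\neg(A\rightarrow B)$; $(A\rightarrow B)\supset(A\supset B)$; $(A\rightarrow B)\supset((\neg A\rightarrow\neg B)\vee(\neg A\wedge B))$; $(A\rightarrow B)\supset(\neg\neg A\rightarrow\neg\neg B)$; $(\neg^kA\rightarrow\neg^lB)\supset((\neg^mA\rightarrow\neg^nB)\vee(\neg^mA\wedge\neg^{n+1}B))$; $(\neg^kA\rightarrow\neg^lB)\supset(\neg^{2m-k}A\rightarrow\neg^{2n-l}B)$; (Dual) $\Diamond A\equiv\neg\Box\neg A$; (K$^\supset$) $\Box(A\supset B)\supset(\Box A\supset\Box B)$; rules: from $A$ and $A\supset B$ infer $B$; from a theorem $A$ infer $\Box A$ (necessitation applies only to theorems). $\Gamma\vdash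 A$: $A$ is derivable from theorems and members of $\Gamma$ using the first rule. *)

(* Defs.v *)
From Stdlib Require Import Arith.

Definition var := nat.

Inductive form : Type :=
| Var (p : var)
| Neg (A : form)
| Box (A : form)
| Dia (A : form)
| And (A B : form)
| Or (A B : form)
| Imp (A B : form).

Declare Scope mbcl_scope.
Delimit Scope mbcl_scope with mbcl.
Bind Scope mbcl_scope with form.

Notation "¬ A" := (Neg A) (at level 35, right associativity) : mbcl_scope.
Notation "□ A" := (Box A) (at level 35, right associativity) : mbcl_scope.
Notation "◇ A" := (Dia A) (at level 35, right associativity) : mbcl_scope.
Notation "A ∧ B" := (And A B) (at level 40, left associativity) : mbcl_scope.
Notation "A ∨ B" := (Or A B) (at level 50, left associativity) : mbcl_scope.
Notation "A ⇾ B" := (Imp A B) (at level 55, right associativity) : mbcl_scope.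

Definition material (A B : form) : form := (¬ A ∨ B)%mbcl.
Notation "A ⊃ B" := (material A B) (at level 60, right associativity) : mbcl_scope.

Definition equiv (A B : form) : form := ((¬ A ∨ B) ∧ (¬ B ∨ A))%mbcl.
Notation "A ≡ B" := (equiv A B) (at level 65, no associativity) : mbcl_scope.

Definition negs (j : nat) (A : form) : form := Nat.iter j Neg A.
Notation "¬^ j A" := (negs j A)
  (at level 35, j at level 9, A at level 35) : mbcl_scope.

Local Open Scope mbcl_scope.

Record frame : Type := Frame {
  world : Type;
  world_nonempty : inhabited world;
  Q : world -> world -> Prop;
  R : world -> form -> form -> Prop
}.

Definition valuation (F : frame) : Type := world F -> var -> bool.

Fixpoint truth (F : frame) (v : valuation F) (w : world F) (A : form) : Prop :=
  match A with
  | Var p => v w p = true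
  | Neg B => ~ truth F v w B
  | Box B => forall u : world F, Q F w u -> truth F v u B
  | Dia B => exists u : world F, Q F w u /\ truth F v u B
  | And B C => truth F v w B /\ truth F v w C
  | Or B C => truth F v w B \/ truth F v w C
  | Imp B C => (~ truth F v w B \/ truth F v w C) /\ R F w B C
  end.

Record rel_conditions (k l m n : nat) (S : form -> form -> Prop) : Prop := {
  cond_a1 : forall A, ~ S A (¬ A);
  cond_a2 : forall A, ~ S (¬ A) A;
  cond_b0 : forall A B, S A B -> ~ S A (¬ B);
  cond_b1 : forall A B, S (A ⇾ B) (¬ (A ⇾ ¬ B));
  cond_b2 : forall A B, S (A ⇾ ¬ B) (¬ (A ⇾ B));
  cond_cun : forall A B, S A B -> S (¬ A) (¬ B);
  cond_cun_klmn : forall A B, S (¬^k A) (¬^l B) -> S (¬^m A) (¬^n B)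
}.

Definition frame_class (k l m n : nat) (F : frame) : Prop :=
  forall w : world F, rel_conditions k l m n (R F w).

Definition entails (k l m n : nat) (Gamma : form -> Prop) (A : form) : Prop :=
  forall (F : frame) (v : valuation F) (w : world F),
    frame_class k l m n F ->
    (forall B : form, Gamma B -> truth F v w B) ->
    truth F v w A.

(* The classical language has the primitive connectives that are classical in
   the modal one; material implication and equivalence are abbreviations. *)
Inductive cform : Type :=
| CVar (p : var)
| CNeg (a : cform)
| CAnd (a b : cform)
| COr (a b : cform).

Fixpoint ceval (e : var -> bool) (a : cform) : bool :=
  match a with
  | CVar p => e p
  | CNeg a => negb (ceval e a)
  | CAnd a b => andb (ceval e a) (ceval e b)
  | COr a b => orb (ceval e a) (ceval e b)
  end.

Definition tautology (a : cform) : Prop :=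
  forall e : var -> bool, ceval e a = true.

Fixpoint csubst (s : var -> form) (a : cform) : form :=
  match a with
  | CVar p => s p
  | CNeg a => ¬ csubst s a
  | CAnd a b => csubst s a ∧ csubst s b
  | COr a b => csubst s a ∨ csubst s b
  end.

(* In [ax_klmn_double], subtraction on [nat] is truncated; it is the genuine
   difference when [k <= m] and [l <= n]. *)
Inductive axiom (k l m n : nat) : form -> Prop :=
| ax_CPL a s : tautology a -> axiom k l m n (csubst s a)
| ax_A1 A : axiom k l m n (¬ (A ⇾ ¬ A))
| ax_A2 A : axiom k l m n (¬ (¬ A ⇾ A))
| ax_B1 A B : axiom k l m n ((A ⇾ B) ⇾ ¬ (A ⇾ ¬ B))
| ax_B2 A B : axiom k l m n ((A ⇾ ¬ B) ⇾ ¬ (A ⇾ B))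
| ax_material A B : axiom k l m n ((A ⇾ B) ⊃ (A ⊃ B))
| ax_cun A B :
    axiom k l m n ((A ⇾ B) ⊃ ((¬ A ⇾ ¬ B) ∨ (¬ A ∧ B)))
| ax_cun_double A B :
    axiom k l m n ((A ⇾ B) ⊃ (¬ ¬ A ⇾ ¬ ¬ B))
| ax_klmn A B :
    axiom k l m n
      ((¬^k A ⇾ ¬^l B) ⊃ ((¬^m A ⇾ ¬^n B) ∨ (¬^m A ∧ ¬^(n + 1) B)))
| ax_klmn_double A B :
    axiom k l m n
      ((¬^k A ⇾ ¬^l B) ⊃ (¬^(2 * m - k) A ⇾ ¬^(2 * n - l) B))
| ax_Dual A : axiom k l m n (◇ A ≡ ¬ □ ¬ A)
| ax_K A B : axiom k l m n (□ (A ⊃ B) ⊃ (□ A ⊃ □ B)).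

Inductive thm (k l m n : nat) : form -> Prop :=
| thm_axiom A : axiom k l m n A -> thm k l m n A
| thm_mp A B : thm k l m n A -> thm k l m n (A ⊃ B) -> thm k l m n B
| thm_nec A : thm k l m n A -> thm k l m n (□ A).

Inductive derives (k l m n : nat) (Gamma : form -> Prop) : form -> Prop :=
| derives_thm A : thm k l m n A -> derives k l m n Gamma A
| derives_mem A : Gamma A -> derives k l m n Gamma A
| derives_mp A B :
    derives k l m n Gamma A -> derives k l m n Gamma (A ⊃ B) ->
    derives k l m n Gamma B.

(* Main.v *)
Require Import Defs.
From Stdlib Require Import Arith Bool Lia Classical ClassicalDescription.

(** An implication is material implication plus an instance of [R_w], so an
    axiom between implications splits into a classical part and a closure
    property of [R_w].  For [ax_klmn_double] the closure property comes from
    applying (cun^{k,l,m,n}) twice, first to [A, B] and then, as [k <= m] and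
    [l <= n], to [¬^(m-k) A, ¬^(n-l) B]; the classical part holds because
    [2m-k] has the parity of [k] and [2n-l] that of [l]. *)

Local Open Scope mbcl_scope.

Lemma negs_add (i j : nat) (A : form) : ¬^(i + j) A = ¬^i (¬^j A).
Proof. apply Nat.iter_add. Qed.

Definition neg_closed (k l m n : nat) (S : form -> form -> Prop) : Prop :=
  forall A B, S (¬^k A) (¬^l B) -> S (¬^m A) (¬^n B).

Lemma neg_closed_trans (k l m n p q : nat) (S : form -> form -> Prop) :
  neg_closed k l m n S -> neg_closed m n p q S -> neg_closed k l p q S.
Proof. unfold neg_closed; auto. Qed.

Lemma neg_closed_add (i j k l m n : nat) (S : form -> form -> Prop) :
  neg_closed k l m n S -> neg_closed (k + i) (l + j) (m + i) (n + j) S.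
Proof. intros HS A B; rewrite !negs_add; apply HS. Qed.

Lemma neg_closed_double (k l m n : nat) (S : form -> form -> Prop) :
  k <= m -> l <= n ->
  neg_closed k l m n S -> neg_closed k l (2 * m - k) (2 * n - l) S.
Proof.
  intros hkm hln HS; apply (neg_closed_trans k l m n); [exact HS|].
  apply (neg_closed_add (m - k) (n - l)) in HS.
  replace (k + (m - k)) with m in HS by lia.
  replace (l + (n - l)) with n in HS by lia.
  replace (2 * m - k) with (m + (m - k)) by lia.
  now replace (2 * n - l) with (n + (n - l)) by lia.
Qed.

Lemma even_double_sub (i j : nat) :
  i <= j -> Nat.even (2 * j - i) = Nat.even i.
Proof.
  intros hij; rewrite Nat.even_sub, Nat.even_mul by lia.
  now destruct (Nat.even i).
Qed.

Section Truth.

Variables (F : frame) (v : valuation F).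

Local Notation "w ⊩ A" := (truth F v w A) (at level 70).

Implicit Types (w : world F) (A B : form).

Lemma truth_material w A B : w ⊩ A ⊃ B <-> (w ⊩ A -> w ⊩ B).
Proof. unfold material; simpl; split; [tauto | apply imply_to_or]. Qed.

Lemma truth_equiv w A B : w ⊩ A ≡ B <-> (w ⊩ A <-> w ⊩ B).
Proof.
  change (w ⊩ A ⊃ B /\ w ⊩ B ⊃ A <-> (w ⊩ A <-> w ⊩ B)).
  now rewrite !truth_material.
Qed.

Lemma truth_imp w A B : w ⊩ A ⇾ B <-> (w ⊩ A -> w ⊩ B) /\ R F w A B.
Proof. rewrite <- truth_material; reflexivity. Qed.

Lemma truth_neg_neg w A : w ⊩ ¬ ¬ A <-> w ⊩ A.
Proof. simpl; split; [apply NNPP | tauto]. Qed.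

Lemma truth_negs w (j : nat) A :
  w ⊩ ¬^j A <-> if Nat.even j then w ⊩ A else w ⊩ ¬ A.
Proof.
  induction j as [|j IH]; [reflexivity|].
  change (~ w ⊩ ¬^j A <-> if Nat.even (S j) then w ⊩ A else w ⊩ ¬ A).
  rewrite IH, Nat.even_succ, <- Nat.negb_even.
  destruct (Nat.even j); [reflexivity | apply truth_neg_neg].
Qed.

Lemma truth_negs_parity w (i j : nat) A :
  Nat.even i = Nat.even j -> w ⊩ ¬^i A <-> w ⊩ ¬^j A.
Proof. intros Hij; now rewrite !truth_negs, Hij. Qed.

Lemma truth_csubst w (s : var -> form) (e : var -> bool) (a : cform) :
  (forall p, w ⊩ s p <-> e p = true) ->
  w ⊩ csubst s a <-> ceval e a = true.
Proof.
  intros He; induction a as [p|a IHa|a IHa b IHb|a IHa b IHb]; simpl.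
  - apply He.
  - now rewrite IHa, negb_true_iff, not_true_iff_false.
  - now rewrite IHa, IHb, andb_true_iff.
  - now rewrite IHa, IHb, orb_true_iff.
Qed.

Lemma truth_csubst_tautology w (s : var -> form) (a : cform) :
  tautology a -> w ⊩ csubst s a.
Proof.
  intros Ha.
  apply (truth_csubst w s
    (fun p => if excluded_middle_informative (w ⊩ s p) then true else false));
    [|apply Ha].
  intros p; destruct (excluded_middle_informative _); easy.
Qed.

Lemma truth_dia_dual w A : w ⊩ ◇ A ≡ ¬ □ ¬ A.
Proof.
  apply truth_equiv; simpl; split.
  - intros [u [Hu HA]] H; exact (H u Hu HA).
  - intros H; apply NNPP; intros HA.
    apply H; intros u Hu HuA; apply HA; now exists u.
Qed.

Lemma truth_box_K w A B : w ⊩ □ (A ⊃ B) ⊃ (□ A ⊃ □ B).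
Proof.
  rewrite !truth_material; intros HAB HA u Hu.
  apply (truth_material u A B); auto.
Qed.

Lemma truth_imp_not_imp_neg w A B :
  (R F w A B -> ~ R F w A (¬ B)) -> w ⊩ A ⇾ B -> ~ w ⊩ A ⇾ ¬ B.
Proof. rewrite !truth_imp; tauto. Qed.

Lemma truth_imp_or_and_neg w A B :
  R F w A B -> w ⊩ (A ⇾ B) ∨ (A ∧ ¬ B).
Proof.
  intros HR; simpl.
  destruct (classic (w ⊩ A)), (classic (w ⊩ B)); tauto.
Qed.

Lemma truth_imp_negs_parity w (k l m n : nat) A B :
  neg_closed k l m n (R F w) ->
  Nat.even m = Nat.even k -> Nat.even n = Nat.even l ->
  w ⊩ ¬^k A ⇾ ¬^l B -> w ⊩ ¬^m A ⇾ ¬^n B.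
Proof.
  rewrite !truth_imp; intros HR Hmk Hnl [Hmat HRkl]; split; [|now apply HR].
  now rewrite (truth_negs_parity w m k A), (truth_negs_parity w n l B).
Qed.

End Truth.

Definition valid (F : frame) (A : form) : Prop :=
  forall (v : valuation F) (w : world F), truth F v w A.

Lemma axiom_valid (k l m n : nat) (F : frame) (A : form) :
  k <= m -> l <= n -> frame_class k l m n F ->
  axiom k l m n A -> valid F A.
Proof.
  intros hkm hln HF HA v w.
  destruct (HF w) as [a1 a2 b0 b1 b2 cun cun_klmn].
  destruct HA as [a s Ha|A|A|A B|A B|A B|A B|A B|A B|A B|A|A B].
  - now apply truth_csubst_tautology.
  - intros [_ H]; exact (a1 _ H).
  - intros [_ H]; exact (a2 _ H).
  - apply truth_imp; split; [|apply b1].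
    apply truth_imp_not_imp_neg, b0.
  - apply truth_imp; split; [|apply b2].
    intros HnB HB; revert HnB; now apply truth_imp_not_imp_neg; [apply b0|].
  - rewrite !truth_material; now intros [H _]%truth_imp.
  - apply truth_material; intros [_ H]%truth_imp.
    destruct (truth_imp_or_and_neg F v w (¬ A) (¬ B) (cun A B H))
      as [Himp|[HA HB]]; [now left | right].
    split; [exact HA | now apply truth_neg_neg].
  - apply truth_material.
    apply (truth_imp_negs_parity F v w 0 0 2 2); [|reflexivity..].
    now apply (neg_closed_double 0 0 1 1); [lia..|].
  - apply truth_material; intros [_ H]%truth_imp.
    rewrite Nat.add_1_r; now apply truth_imp_or_and_neg, cun_klmn.
  - apply truth_material, truth_imp_negs_parity;
      [|now apply even_double_sub..].
    now apply neg_closed_double.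
  - apply truth_dia_dual.
  - apply truth_box_K.
Qed.

Lemma thm_valid (k l m n : nat) (F : frame) (A : form) :
  (forall B, axiom k l m n B -> valid F B) -> thm k l m n A -> valid F A.
Proof.
  intros Hax HA v.
  induction HA as [A HA|A B _ IHA _ IHAB|A _ IHA]; intros w.
  - now apply Hax.
  - now apply (truth_material F v w A B).
  - intros u _; apply IHA.
Qed.

Lemma derives_truth (k l m n : nat) (Gamma : form -> Prop) (F : frame)
    (v : valuation F) (w : world F) (A : form) :
  (forall B, thm k l m n B -> truth F v w B) ->
  (forall B, Gamma B -> truth F v w B) ->
  derives k l m n Gamma A -> truth F v w A.
Proof.
  intros Hthm HGamma HA.
  induction HA as [A HA|A HA|A B _ IHA _ IHAB]; [auto.. |].
  now apply (truth_material F v w A B).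
Qed.

Theorem mainTheorem8 (k l m n : nat) (hkm : k <= m) (hln : l <= n)
    (hk : Nat.Even k) (hl : Nat.Even l) (Gamma : form -> Prop) (A : form) :
  derives k l m n Gamma A -> entails k l m n Gamma A.
Proof.
  intros HA F v w HF HGamma.
  apply (derives_truth k l m n Gamma); [|exact HGamma | exact HA].
  intros B HB; apply (thm_valid k l m n F B); [|exact HB].
  intros C; now apply axiom_valid.
Qed.
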